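(* (1) For every $n\ge1$ and $\pi\in\mathcal{I}_{\mathrm{fpf}}(2n)$, the polynomial $\Upsilon^K_{\pi,(GL_{2n},Sp_{2n})}$ is independent of the choice of labelled path in weak order from $w_0$ to $\pi$ used to compute it. (2) The $\Upsilon^K$-polynomials are stable with respect to the inclusion $\iota_{\mathrm{fpf}}:\mathcal{I}_{\mathrm{fpf}}(2n)\hookrightarrow\mathcal{I}_{\mathrm{fpf}}(2N)$ for any $N\ge n$; that is, for every $\pi\in\mathcal{I}_{\mathrm{fpf}}(2n)$, $$\Upsilon^K_{\iota_{\mathrm{fpf}}(\pi),(GL_{2N},Sp_{2N})}=\Upsilon^K_{\pi,(GL_{2n},Sp_{2n})}.$$
   Context: $\mathcal{I}_{\mathrm{fpf}}(2n)$ is the set of fixed-point-free involutions in $S_{2n}$; $s_i=(i,i+1)$; $\ell$ is Coxeter length; $w_0$ is the longest element, $w_0(i)=2n+1-i$. For $\pi\in\mathcal{I}_{\mathrm{fpf}}(2n)$ and $1\le i\le 2n-1$: (a') if $\ell(s_i\pi)>\ell(\pi)$ or $s_i\pi s_i=\pi$, then $s_i\cdot\pi=\pi$; (b') otherwise $s_i\cdot\pi=s_i\pi s_i$. The weak order on $\mathcal{I}_{\mathrm{fpf}}(2n)$ is generated by the relations $\pi\prec s_i\cdot\pi$ whenever $s_i\cdot\pi\ne\pi$; every element is reachable from the minimum $w_0$. A labelled path from $w_0$ to $\pi$ is an expression $\pi=s_{i_1}\cdot(s_{i_2}\cdot\,\cdots\,(s_{i_l}\cdot w_0)\cdots)$ in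 which each successive application of an $s_{i_k}$ changes the element. Demazure operators: $D_i(f)=\dfrac{x_{i+1}f-x_is_i(f)}{x_{i+1}-x_i}$, where $s_i$ acts on polynomials by swapping $x_i$ and $x_{i+1}$. $\Upsilon^K$-polynomials: $\Upsilon^K_{w_0,(GL_{2n},Sp_{2n})}=\prod_{1\le i<j\le 2n-i}(1-x_ix_j)$, and for a labelled path $\pi=s_{i_1}\cdot(\cdots(s_{i_l}\cdot w_0)\cdots)$ one defines $\Upsilon^K_{\pi,(GL_{2n},Sp_{2n})}:=D_{i_1}D_{i_2}\cdots D_{i_l}\,\Upsilon^K_{w_0,(GL_{2n},Sp_{2n})}$. The map $\iota_{\mathrm{fpf}}:S_{2n}\hookrightarrow S_{2N}$ sends $\pi$ to the permutation which coincides with $\pi$ on $\{1,\ldots,2n\}$ and which transposes $i$ and $i+1$ for $i=2n+1,2n+3,\ldots,2N-1$. *)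

(* Defs.v *)
From HB Require Import structures.
From mathcomp Require Import all_boot all_order all_algebra all_fingroup.
From mathcomp Require Import zify.
From mathcomp.multinomials Require Import mpoly.

Set Implicit Arguments.
Unset Strict Implicit.
Unset Printing Implicit Defensive.

Import GRing.Theory.

(* Positions 1, ..., m are encoded by the ordinals 0, ..., m.-1 of 'I_m, and
   the indices of the simple reflections s_1, ..., s_(m-1) by 'I_m.-1. *)

Section Simple.
Variable m : nat.
Implicit Types (i : 'I_m.-1) (p q : 'S_m).

Lemma hi_subproof i : i.+1 < m.
Proof. by rewrite -ltn_predRL. Qed.

Definition lo i : 'I_m := widen_ord (leq_pred m) i.
Definition hi i : 'I_m := Ordinal (hi_subproof i).

Definition simple i : 'S_m := tperm (lo i) (hi i).

Lemma lo_neq_hi i : lo i != hi i.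
Proof. by rewrite -val_eqE /=; lia. Qed.

Lemma simpleK i : (simple i * simple i = 1)%g.
Proof. exact: tperm2. Qed.

Definition invset p : {set 'I_m * 'I_m} :=
  [set ij : 'I_m * 'I_m | (ij.1 < ij.2) && (p ij.2 < p ij.1)].

Lemma val_simple i (a : 'I_m) :
  simple i a = (if a == i :> nat then i.+1 else if a == i.+1 :> nat then nat_of_ord i
                else a) :> nat.
Proof.
rewrite /simple; case: tpermP => [->|->|/eqP + /eqP] /=; rewrite -?val_eqE /=.
- by rewrite eqxx.
- by rewrite eqxx; case: eqP => // /eqP; lia.
- by move=> /negPf -> /negPf ->.
Qed.

Lemma simple_mono i (a b : 'I_m) :
  a < b -> (a, b) != (lo i, hi i) -> simple i a < simple i b.
Proof.
by rewrite xpair_eqE -!val_eqE !val_simple /=; do !case: eqP => //=; lia.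
Qed.

Lemma invset_up p i : p (lo i) < p (hi i) ->
  #|invset (simple i * p)| = #|invset p|.+1.
Proof.
move=> asc; pose f (ab : 'I_m * 'I_m) := (simple i ab.1, simple i ab.2).
have sK : involutive (simple i) by exact: tpermK.
have fK : involutive f by move=> [a b]; rewrite /f /= !sK.
have -> : invset (simple i * p) = (lo i, hi i) |: f @: invset p.
  apply/setP=> -[a b]; have := mem_imset (invset p) (f (a, b)) (inv_inj fK).
  rewrite fK => mem; rewrite !inE mem inE /= !permM.
  have [/eqP[-> ->]|ne] /= := boolP ((a, b) == (lo i, hi i)).
    rewrite /simple tpermL tpermR asc andbT; lia.
  have [ab|ba] := boolP (a < b) => /=.
    by rewrite (simple_mono ab ne).
  apply/esym/negP=> /andP[ab' lt].
  have [/eqP[ea eb]|] := boolP ((simple i a, simple i b) == (lo i, hi i)).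
    by move: lt asc; rewrite ea eb; lia.
  by move/(simple_mono ab'); rewrite !sK (negPf ba).
rewrite cardsU1 card_imset ?add1n; last exact: inv_inj.
suff -> : (lo i, hi i) \notin f @: invset p by [].
apply/imsetP=> -[[a b]]; rewrite inE /f /= => /andP[ab _] [e1 e2].
have := congr1 (simple i) e1; have := congr1 (simple i) e2.
by rewrite !sK /simple tpermL tpermR => eb ea; move: ab; rewrite -eb -ea /=; lia.
Qed.

Lemma invset_down p i : p (hi i) < p (lo i) ->
  #|invset p| = #|invset (simple i * p)|.+1.
Proof.
move=> desc; rewrite -(@invset_up _ i) ?mulgA ?simpleK ?mul1g //.
by rewrite !permM /simple tpermL tpermR.
Qed.

Lemma simple_lt_or p i : (p (lo i) < p (hi i)) || (p (hi i) < p (lo i)).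
Proof.
rewrite -neq_ltn; apply: contra (lo_neq_hi i) => /eqP /val_inj e.
exact/eqP/(perm_inj e).
Qed.

Lemma invset_le p i : #|invset (simple i * p)| <= #|invset p|.+1.
Proof.
by case/orP: (simple_lt_or p i) => [/invset_up|/invset_down] ->; lia.
Qed.

Lemma invsetV p : #|invset p^-1| = #|invset p|.
Proof.
pose f (ab : 'I_m * 'I_m) := (p ab.2, p ab.1).
have fI : injective f by move=> [a b] [c d] [/perm_inj -> /perm_inj ->].
rewrite -(card_imset (invset p) fI); apply: eq_card => -[a b].
apply/idP/imsetP => [|[[c d] + [-> ->]]]; rewrite !inE /=.
  move=> H; exists ((p^-1)%g b, (p^-1)%g a); last by rewrite /f /= !permKV.
  by rewrite inE /= !permKV andbC.
by rewrite !permK andbC.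
Qed.

Lemma ascending_id p : (forall i, p (lo i) < p (hi i)) -> p = 1%g.
Proof.
move=> asc.
have mono (a b : 'I_m) : a < b -> p a < p b.
  move: {2}(b - a) (leqnn (b - a)) => k.
  elim: k b => [|k IH] b le_k ab; first by lia.
  have bm := ltn_ord b.
  have im : b.-1 < m.-1 by lia.
  have eh : hi (Ordinal im) = b by apply: val_inj => /=; lia.
  have := asc (Ordinal im); rewrite eh.
  have [-> //|ne] := eqVneq (lo (Ordinal im)) a.
  apply: ltn_trans; apply: IH => /=; first by lia.
  by move: ne; rewrite -val_eqE /=; lia.
have monoV (a b : 'I_m) : a < b -> (p^-1)%g a < (p^-1)%g b.
  move=> ab; rewrite ltnNge leq_eqVlt; apply/negP=> /orP[/eqP/val_inj|/mono].
    by move/perm_inj => e; rewrite e ltnn in ab.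
  by rewrite !permKV; lia.
have ge q : (forall a b : 'I_m, a < b -> q a < q b) -> forall a : 'I_m, a <= q a.
  move=> mq [a am] /=; elim: a am => // a IHa am.
  have am' : a < m by lia.
  by apply: leq_ltn_trans (IHa am') _; apply: mq => /=.
apply/permP=> a; rewrite perm1; apply: val_inj; apply/eqP.
rewrite eqn_leq ge // andbT.
by have := ge _ monoV (p a); rewrite permK.
Qed.

Lemma ascent_or_id p : p = 1%g \/ exists i, p (hi i) < p (lo i).
Proof.
have [/existsP|/existsPn noasc] := boolP [exists i, p (hi i) < p (lo i)].
  by right.
left; apply: ascending_id => i; have := simple_lt_or p i.
by rewrite (negPf (noasc i)) orbF.
Qed.

Definition has_word p (k : nat) : bool :=
  [exists t : k.-tuple 'I_m.-1, p == (\prod_(i <- t) simple i)%g].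

Lemma has_word_invset p : has_word p #|invset p|.
Proof.
move: {2}#|invset p| (erefl #|invset p|) => k.
elim: k p => [|k IH] p ek; have [e|[i desc]] := ascent_or_id p.
- rewrite ek; apply/existsP; exists [tuple]; by rewrite big_nil e.
- by move: ek; rewrite (invset_down desc).
- move: ek; have -> : invset p = set0; last by rewrite cards0.
  by apply/setP=> -[a b]; rewrite e !inE /= !perm1; lia.
- move: ek; rewrite (invset_down desc) => -[ek].
  have /existsP[t /eqP e] := IH _ ek; apply/existsP.
  by exists (cons_tuple i t); rewrite big_cons -e mulgA simpleK mul1g.
Qed.

Lemma invset_word (t : seq 'I_m.-1) :
  #|invset (\prod_(i <- t) simple i)| <= size t.
Proof.
elim: t => [|i t IH] /=.
  rewrite big_nil (_ : invset 1 = set0) ?cards0 //.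
  by apply/setP=> -[a b]; rewrite !inE /= !perm1; lia.
by rewrite big_cons; apply: leq_trans (invset_le _ _) _.
Qed.

Lemma ex_has_word p : exists k, has_word p k.
Proof. by exists #|invset p|; exact: has_word_invset. Qed.

Definition coxeter_length p : nat := ex_minn (ex_has_word p).

Lemma coxeter_lengthE p : coxeter_length p = #|invset p|.
Proof.
rewrite /coxeter_length; case: ex_minnP => k /existsP[t /eqP e] le_k.
apply/eqP; rewrite eqn_leq le_k ?has_word_invset //=.
by rewrite e -[X in _ <= X](size_tuple t) invset_word.
Qed.

(* Permutations compose as functions in the mathematics, but
   [(p * q) x = q (p x)] here; so s_i p is [p * simple i]. *)
Definition lmul_simple i p : 'S_m := (p * simple i)%g.
Definition conj_simple i p : 'S_m := (simple i * p * simple i)%g.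

Definition act i p : 'S_m :=
  if (coxeter_length p < coxeter_length (lmul_simple i p))
     || (conj_simple i p == p)
  then p else conj_simple i p.

Definition fpf_involutions : {set 'S_m} :=
  [set p : 'S_m | (p * p == 1)%g && [forall x, p x != x]].

Definition w0 : 'S_m := perm (@rev_ord_inj m).

(* The word [:: i_1; ...; i_l] encodes s_(i_1) . ( ... (s_(i_l) . w_0)). *)
Definition act_word (w : seq 'I_m.-1) : 'S_m := foldr act w0 w.

Fixpoint all_steps_move (w : seq 'I_m.-1) : bool :=
  if w is i :: w' then (act_word w != act_word w') && all_steps_move w'
  else true.

Definition labelled_path (w : seq 'I_m.-1) p : bool :=
  all_steps_move w && (act_word w == p).

Lemma labelled_path_exists p :
  p \in fpf_involutions -> exists w, labelled_path w p.
Proof.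
have bnd q : #|invset q| <= #|{: 'I_m * 'I_m}| by exact: max_card.
move: {2}(_ - _) (erefl (#|{: 'I_m * 'I_m}| - #|invset p|)) => k.
elim/ltn_ind: k p => k IH p ek fp.
have [e|[i]] := ascent_or_id (p * w0)%g.
  exists [::]; rewrite /labelled_path /= eq_sym; apply/eqP.
  have w0K : (w0 * w0 = 1)%g.
    by apply/permP=> x; rewrite permM !permE rev_ordK.
  by rewrite -[p]mulg1 -w0K mulgA e mul1g.
have pE x : val ((p * w0)%g x) = m - (p x).+1 by rewrite permM permE.
rewrite !pE => asc'; have asc : p (lo i) < p (hi i).
  by have := ltn_ord (p (hi i)); have := ltn_ord (p (lo i)); lia.
move: (fp); rewrite inE => /andP[/eqP pp /forallP fpf].
have pK x : p (p x) = x by rewrite -permM pp perm1.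
have pV : (p^-1)%g = p by rewrite -[RHS]mulg1 -(mulgV p) mulgA pp mul1g.
set q := conj_simple i p.
have fq : q \in fpf_involutions.
  rewrite inE; apply/andP; split.
    rewrite /q /conj_simple !mulgA -[(_ * p * _ * _)%g]mulgA simpleK mulg1.
    by rewrite -[(_ * p * p)%g]mulgA pp mulg1 simpleK.
  apply/forallP=> x; rewrite /q /conj_simple !permM.
  apply: contra (fpf (simple i x)) => /eqP e.
  by rewrite -[p _](tpermK (lo i) (hi i)) -/(simple i) e.
have qs : lmul_simple i q = (simple i * p)%g.
  by rewrite /lmul_simple /q /conj_simple -mulgA simpleK mulg1.
have l1 := invset_up asc.
have l2 : #|invset q| = #|invset p|.+2.
  have -> : #|invset p|.+1 = #|invset (p * simple i)|.
    by rewrite -[RHS]invsetV invMg pV [(simple i)^-1%g]tpermV -l1.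
  rewrite /q /conj_simple -mulgA; apply: invset_up; rewrite !permM.
  have ne : (p (lo i), p (hi i)) != (lo i, hi i).
    by rewrite xpair_eqE negb_and fpf.
  exact: simple_mono.
have qp : q != p by apply/eqP=> e; move: l2; rewrite e; lia.
have qK : conj_simple i q = p.
  rewrite /q /conj_simple -!mulgA simpleK mulg1.
  by rewrite mulgA simpleK mul1g.
have aq : act i q = p.
  rewrite /act !coxeter_lengthE qs l1 l2 qK [p == q]eq_sym (negPf qp) orbF.
  by rewrite ltnNge leqnSn.
have lt : #|{: 'I_m * 'I_m}| - #|invset q| < k.
  by have := bnd q; lia.
have [w /andP[mw /eqP ew]] := IH _ lt q erefl fq.
exists (i :: w).
by rewrite /labelled_path /= -!/(act_word _) ew aq eq_sym qp mw eqxx.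
Qed.

End Simple.

Section Demazure.
Variable m : nat.
Local Open Scope ring_scope.
Implicit Types (i : 'I_m.-1) (f g : {mpoly int[m]}).

Definition demazure_numerator i f : {mpoly int[m]} :=
  'X_(hi i) * f - 'X_(lo i) * msym (simple i) f.

Lemma demazure_exists i f :
  exists g, ('X_(hi i) - 'X_(lo i)) * g == demazure_numerator i f.
Proof.
pose d : {mpoly int[m]} := 'X_(hi i) - 'X_(lo i).
have -> : demazure_numerator i f = d * f + 'X_(lo i) * (f - msym (simple i) f).
  by rewrite /demazure_numerator /d mulrBl mulrBr addrA subrK.
suff [g e] : exists g, d * g = f - msym (simple i) f.
  by exists (f + 'X_(lo i) * g); rewrite mulrDr -e mulrCA.
pose P h := exists g, d * g = h - msym (simple i) h.
have PM h1 h2 : P h1 -> P h2 -> P (h1 * h2).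
  move=> [g1 e1] [g2 e2]; exists (g1 * h2 + msym (simple i) h1 * g2).
  by rewrite mulrDr mulrA e1 mulrCA e2 msymM mulrBl mulrBr addrA subrK.
have P1 : P 1 by exists 0; rewrite mulr0 msym1 subrr.
have PX j : P 'X_j.
  rewrite /P /msym mmapX mmap1U /simple.
  case: tpermP => [->|->|_ _].
  - by exists (-1); rewrite mulrN1 opprB.
  - by exists 1; rewrite mulr1.
  - by exists 0; rewrite mulr0 subrr.
rewrite -/(P f); elim/mpolyind: f => [|c k f _ _ [g e]].
  by exists 0; rewrite mulr0 msym0 subrr.
have [g' e'] : P 'X_[k].
  rewrite mpolyXE_id; elim/big_ind: _ => // j _.
  by elim: (k j) => [|l IHl]; rewrite ?expr0 // exprS; exact: PM.
exists (c *: g' + g).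
by rewrite mulrDr -scalerAr e e' msymD msymZ scalerBr opprD addrACA.
Qed.

(* The quotient is exact, and unique because {mpoly int[m]} is a domain. *)
Definition demazure i f : {mpoly int[m]} := xchoose (demazure_exists i f).

Definition demazure_word (w : seq 'I_m.-1) f : {mpoly int[m]} :=
  foldr demazure f w.

(* In 1-based indices, the condition is i < j <= m - i. *)
Definition UpsilonK_w0 : {mpoly int[m]} :=
  \prod_(i < m) \prod_(j < m | (i < j)%N && (i.+1 + j.+1 <= m)%N)
    (1 - 'X_i * 'X_j).

(* Computed along one choice of labelled path. *)
Definition UpsilonK (p : 'S_m) (fp : p \in fpf_involutions m) :
    {mpoly int[m]} :=
  demazure_word (xchoose (labelled_path_exists fp)) UpsilonK_w0.

End Demazure.

Section Iota.
Variables (n N : nat) (leN : n <= N).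

Lemma le_double : n.*2 <= N.*2.
Proof. by rewrite leq_double. Qed.

Lemma partner_subproof (x : 'I_N.*2) : (if odd x then x.-1 else x.+1) < N.*2.
Proof. by have := ltn_ord x; case: ifP; lia. Qed.

(* In 1-based indices, exchanges i and i + 1 for every odd i. *)
Definition partner (x : 'I_N.*2) : 'I_N.*2 := Ordinal (partner_subproof x).

Definition iota_fpf_fun (p : 'S_n.*2) (x : 'I_N.*2) : 'I_N.*2 :=
  if insub (val x) : option 'I_n.*2 is Some y then widen_ord le_double (p y)
  else partner x.

Lemma partnerK : involutive partner.
Proof.
move=> x; apply: val_inj => /=; case: (boolP (odd x)) => ox.
  by rewrite ifN; lia.
by rewrite ifT; lia.
Qed.

Variant iota_spec p x : bool -> 'I_N.*2 -> Prop :=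
| IotaLow (y : 'I_n.*2) of x = widen_ord le_double y :
    iota_spec p x true (widen_ord le_double (p y))
| IotaHigh of n.*2 <= x & n.*2 <= partner x : iota_spec p x false (partner x).

Lemma iotaP (p : 'S_n.*2) x : iota_spec p x (x < n.*2) (iota_fpf_fun p x).
Proof.
rewrite /iota_fpf_fun; case: insubP => [y -> e|]; last rewrite -leqNgt /= => h.
  by constructor; apply: val_inj.
by rewrite ltnNge h; constructor => //=; case: ifP; lia.
Qed.

Lemma iota_fpf_inj p : injective (iota_fpf_fun p).
Proof.
move=> x y; case: iotaP => [x' ->|hx hx']; case: iotaP => [y' ->|hy hy'].
- by move/(congr1 val) => /= /val_inj/perm_inj ->.
- by move/(congr1 val) => e; have := ltn_ord (p x'); move: hy'; rewrite -e /=; lia.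
- by move/(congr1 val) => e; have := ltn_ord (p y'); move: hx'; rewrite e /=; lia.
- exact: (inv_inj partnerK).
Qed.

Definition iota_fpf (p : 'S_n.*2) : 'S_N.*2 := perm (@iota_fpf_inj p).

Lemma iota_fpf_in (p : 'S_n.*2) :
  p \in fpf_involutions n.*2 -> iota_fpf p \in fpf_involutions N.*2.
Proof.
rewrite !inE => /andP[/eqP pp /forallP fpf].
have wI : injective (widen_ord le_double).
  by move=> a b /(congr1 val) /= /val_inj.
apply/andP; split.
  apply/eqP/permP=> x; rewrite permM perm1 !permE.
  case: (iotaP p x) => [y ->|h h'].
    case: iotaP => [z /wI <-|/=]; last by have := ltn_ord (p y); lia.
    by rewrite -permM pp perm1.
  case: iotaP => [z e|_ _]; last exact: partnerK.
  by move: h'; rewrite e /=; have := ltn_ord z; lia.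
apply/forallP=> x; rewrite permE; case: iotaP => [y ->|h h'].
  by rewrite (inj_eq wI).
by rewrite -val_eqE /=; case: ifP; lia.
Qed.

Definition widen_vars (f : {mpoly int[n.*2]}) : {mpoly int[N.*2]} :=
  f \mPo [tuple 'X_(widen_ord le_double i) | i < n.*2].

End Iota.

(* Main.v *)
Require Import Defs.
From mathcomp Require Import all_boot all_order all_algebra all_fingroup.
From mathcomp Require Import zify ring.
From mathcomp.multinomials Require Import mpoly.

(** Both parts come from one statement about labelled paths: the polynomial
    obtained along a path depends only on the endpoint ([path_value_coherent]).
    It is proved by induction on the number of non-inversions of [p], so going
    up towards [w0].  The last letter of a path to [p] is an ascent of [p], and
    [p] is covered by its conjugate by that letter.  Two paths whose last
    letters are the ascents [i <> j] are compared inside the dihedral group of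
    [s_i] and [s_j].

    If [j = i + 1], then the values of [p] at the three positions involved
    increase; as [p] is a fixed-point-free involution, they avoid these three
    positions.  The conjugates of [p] then form a hexagon and the braid relation
    for Demazure operators concludes ([hexagon]).  If [|i - j| > 1], the
    conjugates form a square and commutation concludes, except when [p] sends
    [i, i + 1] to [j, j + 1] in this order.  In that case conjugation by [s_i]
    and by [s_j] leads to the same [q], which has nested arcs [i -- j + 1] and
    [i + 1 -- j], and one needs [D_i f = D_j f] for the polynomial [f] of [q]
    ([square]).

    This last identity is pushed up to [w0] as well ([mirrored_step]).  An
    ascent [k] of [q] that is not adjacent to [i] or [j] keeps the two arcs in
    place and its operator commutes with [D_i] and [D_j].  If [k] is adjacent to
    [i], then moving up by [k] and then [i] gives an element in which [k], [j]
    are nested, and [D_i D_k D_i = D_k D_i D_k] transfers the identity.  At [w0]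
    the nested pairs are the mirror pairs [s_i], [s_(2n-i)]; there
    [D_i] and [D_(2n-i)] both just delete the factor [1 - x_i x_(2n-i)]
    ([demazure_w0_mirror]).

    For stability it remains to find, for the image of [w0] under
    [iota_fpf] from [2n] to [2n + 2] points, one path that gives the right
    polynomial: everything below [w0] is then carried over letter by letter
    ([path_value_widen]).  The word that applies [s_1], then [s_2], up to
    [s_(2n)] works: it carries the partner of the last position from the first
    position to the last but one, and each of its Demazure operators deletes
    exactly one factor ([sweep]).

    All the products met on the way are instances of [weighted_product], where
    deleting a factor amounts to raising the weight of one variable by one. *)

Set Implicit Arguments.
Unset Strict Implicit.
Unset Printing Implicit Defensive.

Import GRing.Theory.

(** * Relations between divided sums in an integral domain *)

Section RankTwo.
Local Open Scope ring_scope.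
Variable R : idomainType.

(** Applying [s], which exchanges [a] and [b], changes the sign of [b - a] and of
    [b f - a (s f)], hence preserves their quotient. *)
Lemma divided_sum_sym (s : {rmorphism R -> R}) a b f g :
    a != b -> s a = b -> s b = a -> involutive s ->
  (b - a) * g = b * f - a * s f -> s g = g.
Proof.
move=> ab sa sb sK e; have := congr1 s e.
rewrite !(rmorphB, rmorphM) /= sa sb sK => e'.
have ba : b - a != 0 by rewrite subr_eq0 eq_sym.
apply: (mulfI ba); rewrite e -opprB mulNr e'; ring.
Qed.

(** Clearing denominators, both words of length three give the antisymmetrization
    of [c^2 b f] over the symmetric group of [a, b, c].  The hypothesis
    [s g = g] makes the coefficient of [g] collect into [c^2 (b - a)], which is
    divisible by the denominator [b - a] of [g]. *)
Lemma braid_word_121 (s t : {rmorphism R -> R}) a b c f g h k :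
    s a = b -> s b = a -> s c = c -> t a = a -> t b = c -> t c = b -> s g = g ->
    (b - a) * g = b * f - a * s f -> (c - b) * h = c * g - b * t g ->
    (b - a) * k = b * h - a * s h ->
  (b - a) * (c - a) * (c - b) * k =
    c ^+ 2 * (b * f - a * s f) - b ^+ 2 * (c * t f - a * t (s f))
    + a ^+ 2 * (c * s (t f) - b * s (t (s f))).
Proof.
move=> sa sb sc ta tb tc sg eg eh ek.
have esh := congr1 s eh; rewrite !(rmorphB, rmorphM) /= sb sc sg in esh.
have etg := congr1 t eg; rewrite !(rmorphB, rmorphM) /= ta tb in etg.
have estg := congr1 s etg; rewrite !(rmorphB, rmorphM) /= sa sc in estg.
rewrite -eg -etg -estg.
have -> : (b - a) * (c - a) * (c - b) * k = (c - a) * (c - b) * ((b - a) * k).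
  by ring.
rewrite ek.
have -> : (c - a) * (c - b) * (b * h - a * s h) =
  b * (c - a) * ((c - b) * h) - a * (c - b) * ((c - a) * s h) by ring.
rewrite eh esh.
move: (t g) (s (t g)) => u v; ring.
Qed.

Lemma braid_word_212 (s t : {rmorphism R -> R}) a b c f g h k :
    s a = b -> s b = a -> s c = c -> t a = a -> t b = c -> t c = b -> t g = g ->
    (c - b) * g = c * f - b * t f -> (b - a) * h = b * g - a * s g ->
    (c - b) * k = c * h - b * t h ->
  (b - a) * (c - a) * (c - b) * k =
    c ^+ 2 * (b * f - a * s f) - b ^+ 2 * (c * t f - a * t (s f))
    + a ^+ 2 * (c * s (t f) - b * t (s (t f))).
Proof.
move=> sa sb sc ta tb tc tg eg eh ek.
have eth := congr1 t eh; rewrite !(rmorphB, rmorphM) /= ta tb tg in eth.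
have esg := congr1 s eg; rewrite !(rmorphB, rmorphM) /= sb sc in esg.
have etsg := congr1 t esg; rewrite !(rmorphB, rmorphM) /= ta tc in etsg.
have -> : c ^+ 2 * (b * f - a * s f) - b ^+ 2 * (c * t f - a * t (s f))
    + a ^+ 2 * (c * s (t f) - b * t (s (t f))) =
  b * c * (c * f - b * t f) - a * c * (c * s f - a * s (t f))
   + a * b * (b * t (s f) - a * t (s (t f))).
  move: (s f) (t f) (s _) (t _) (t _) => ? ? ? ? ?; ring.
rewrite -eg -esg -etsg.
have -> : (b - a) * (c - a) * (c - b) * k = (b - a) * (c - a) * ((c - b) * k).
  by ring.
rewrite ek.
have -> : (b - a) * (c - a) * (c * h - b * t h) =
  c * (c - a) * ((b - a) * h) - b * (b - a) * ((c - a) * t h) by ring.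
rewrite eh eth.
move: (s g) (t (s g)) => u v; ring.
Qed.

Lemma commuting_word (s t : {rmorphism R -> R}) a b c d f g h :
    s c = c -> s d = d ->
    (d - c) * g = d * f - c * t f -> (b - a) * h = b * g - a * s g ->
  (b - a) * (d - c) * h = b * (d * f - c * t f) - a * (d * s f - c * s (t f)).
Proof.
move=> sc sd eg eh.
have esg := congr1 s eg; rewrite !(rmorphB, rmorphM) /= sc sd in esg.
rewrite -eg -esg.
have -> : (b - a) * (d - c) * h = (d - c) * ((b - a) * h) by ring.
rewrite eh; move: (s g) => ?; ring.
Qed.

Lemma commuting_quotients (s t : {rmorphism R -> R}) a b c d f g h g' h' :
    a != b -> c != d -> s c = c -> s d = d -> t a = a -> t b = b ->
    s (t f) = t (s f) ->
    (d - c) * g = d * f - c * t f -> (b - a) * h = b * g - a * s g ->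
    (b - a) * g' = b * f - a * s f -> (d - c) * h' = d * g' - c * t g' ->
  h = h'.
Proof.
move=> ab cd sc sd ta tb st eg eh eg' eh'.
have e := commuting_word sc sd eg eh; have e' := commuting_word ta tb eg' eh'.
have ba : b - a != 0 by rewrite subr_eq0 eq_sym.
have dc : d - c != 0 by rewrite subr_eq0 eq_sym.
apply: (mulfI (mulf_neq0 ba dc)); rewrite e.
transitivity ((d - c) * (b - a) * h'); last by rewrite [(d - c) * _]mulrC.
by rewrite e' -st; move: (s f) (t f) (s _) => ? ? ?; ring.
Qed.

Lemma braid_quotients (s t : {rmorphism R -> R}) a b c f g h k g' h' k' :
    a != b -> b != c -> a != c ->
    s a = b -> s b = a -> s c = c -> t a = a -> t b = c -> t c = b ->
    s g = g -> t g' = g' -> s (t (s f)) = t (s (t f)) ->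
    (b - a) * g = b * f - a * s f -> (c - b) * h = c * g - b * t g ->
    (b - a) * k = b * h - a * s h ->
    (c - b) * g' = c * f - b * t f -> (b - a) * h' = b * g' - a * s g' ->
    (c - b) * k' = c * h' - b * t h' ->
  k = k'.
Proof.
move=> ab bc ac sa sb sc ta tb tc sg tg sts eg eh ek eg' eh' ek'.
have e := braid_word_121 sa sb sc ta tb tc sg eg eh ek.
have e' := braid_word_212 sa sb sc ta tb tc tg eg' eh' ek'.
have ba : b - a != 0 by rewrite subr_eq0 eq_sym.
have cb : c - b != 0 by rewrite subr_eq0 eq_sym.
have ca : c - a != 0 by rewrite subr_eq0 eq_sym.
by apply: (mulfI (mulf_neq0 (mulf_neq0 ba ca) cb)); rewrite e e' sts.
Qed.

End RankTwo.

(** * Simple reflections *)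

Section SimpleReflections.
Variable m : nat.
Implicit Types (i j : 'I_m.-1) (x : 'I_m).

Lemma simple_lo i : simple i (lo i) = hi i.
Proof. exact: tpermL. Qed.

Lemma simple_hi i : simple i (hi i) = lo i.
Proof. exact: tpermR. Qed.

Lemma simple_fix i x : x != lo i -> x != hi i -> simple i x = x.
Proof. by move=> xl xh; rewrite /simple tpermD // eq_sym. Qed.

Lemma simple_inv i : involutive (simple i).
Proof. exact: tpermK. Qed.

Lemma simple_comm i j : i.+1 < j -> commute (simple i) (simple j).
Proof.
move=> ij; apply/permP=> x; apply: val_inj => /=.
by rewrite !permM !val_simple; repeat case: ifPn; lia.
Qed.

Lemma simple_braid i j : j = i.+1 :> nat ->
  (simple i * simple j * simple i = simple j * simple i * simple j)%g.
Proof.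
move=> ij; have hl : hi i = lo j by apply: val_inj; rewrite /= ij.
have [a1 a2] : simple i (hi j) = hi j /\ simple j (lo i) = lo i.
  by split; apply: simple_fix; rewrite -val_eqE /=; lia.
have conjE k l : (simple k * simple l * simple k = simple l ^ simple k)%g.
  by rewrite conjgE /simple tpermV mulgA.
have conjtE (s : 'S_m) l : (simple l ^ s = tperm (s (lo l)) (s (hi l)))%g.
  exact: tpermJ.
by rewrite !conjE !conjtE -hl simple_hi a1 a2 hl simple_lo.
Qed.

End SimpleReflections.

(** * Relations between Demazure operators *)

Section DemazureRelations.
Variable m : nat.
Local Open Scope ring_scope.
Implicit Types (i j : 'I_m.-1) (f g : {mpoly int[m]}).

Lemma msym_var (s : 'S_m) x : msym s ('X_x : {mpoly int[m]}) = 'X_(s x).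
Proof. by rewrite /msym mmapX mmap1U. Qed.

Lemma msym_simpleK i : involutive (@msym m int (simple i)).
Proof. by move=> f; rewrite -msymMm simpleK msym1m. Qed.

Lemma var_inj : injective (fun x : 'I_m => 'X_x : {mpoly int[m]}).
Proof.
move=> x y /(congr1 (fun f : {mpoly int[m]} => f@_(U_(x)%MM))).
rewrite !mcoeffX eqxx; case: (U_(y)%MM =P U_(x)%MM) => // e _.
have := congr1 (fun M : 'X_{1..m} => M x) e.
by rewrite /= !mnmE eqxx; case: eqP.
Qed.

Lemma lo_hi_subr_neq0 i : 'X_(hi i) - 'X_(lo i) != 0 :> {mpoly int[m]}.
Proof. by rewrite subr_eq0 (inj_eq var_inj) eq_sym lo_neq_hi. Qed.

Lemma demazureE i f :
  ('X_(hi i) - 'X_(lo i)) * demazure i f =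
  'X_(hi i) * f - 'X_(lo i) * msym (simple i) f.
Proof. exact/eqP/(xchooseP (demazure_exists i f)). Qed.

Lemma demazure_unique i f g :
  ('X_(hi i) - 'X_(lo i)) * g = 'X_(hi i) * f - 'X_(lo i) * msym (simple i) f ->
  demazure i f = g.
Proof.
by rewrite -demazureE => e; apply: (mulfI (lo_hi_subr_neq0 i)).
Qed.

Lemma msym_demazure i f : msym (simple i) (demazure i f) = demazure i f.
Proof.
apply: (@divided_sum_sym _ _ 'X_(lo i) 'X_(hi i) f); last exact: demazureE.
- by rewrite (inj_eq var_inj) lo_neq_hi.
- by rewrite /= msym_var simple_lo.
- by rewrite /= msym_var simple_hi.
- exact: msym_simpleK.
Qed.

Lemma demazure_symM i f g :
  msym (simple i) f = f -> demazure i (f * g) = f * demazure i g.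
Proof.
move=> sf; apply: demazure_unique.
by rewrite mulrCA demazureE msymM sf; ring.
Qed.

Lemma demazure_comm i j f : (i.+1 < j)%N ->
  demazure i (demazure j f) = demazure j (demazure i f).
Proof.
move=> ij.
have [a1 a2 a3 a4] : [/\ simple i (lo j) = lo j, simple i (hi j) = hi j,
    simple j (lo i) = lo i & simple j (hi i) = hi i].
  by split; apply: simple_fix; rewrite -val_eqE /=; lia.
apply: (commuting_quotients (s := msym (simple i)) (t := msym (simple j))
  _ _ _ _ _ _ _ (demazureE j f) (demazureE i _) (demazureE i f) (demazureE j _)).
- by rewrite (inj_eq var_inj) lo_neq_hi.
- by rewrite (inj_eq var_inj) lo_neq_hi.
- by rewrite /= msym_var a1.
- by rewrite /= msym_var a2.
- by rewrite /= msym_var a3.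
- by rewrite /= msym_var a4.
- by rewrite /= -!msymMm (simple_comm ij).
Qed.

Lemma demazure_braid i j f : j = i.+1 :> nat ->
  demazure i (demazure j (demazure i f)) = demazure j (demazure i (demazure j f)).
Proof.
move=> ij; have hl : lo j = hi i by apply: val_inj; rewrite /= ij.
have [a1 a2] : simple i (hi j) = hi j /\ simple j (lo i) = lo i.
  by split; apply: simple_fix; rewrite -val_eqE /=; lia.
have a3 := simple_lo j; have a4 := simple_hi j; have g := demazureE j.
rewrite hl in a3 a4 g.
apply: (braid_quotients (s := msym (simple i)) (t := msym (simple j))
  _ _ _ _ _ _ _ _ _ (msym_demazure i f) (msym_demazure j f) _
  (demazureE i f) (g _) (demazureE i _) (g f) (demazureE i _) (g _)).
- by rewrite (inj_eq var_inj) lo_neq_hi.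
- by rewrite (inj_eq var_inj) -hl lo_neq_hi.
- by rewrite (inj_eq var_inj) -val_eqE /=; lia.
- by rewrite /= msym_var simple_lo.
- by rewrite /= msym_var simple_hi.
- by rewrite /= msym_var a1.
- by rewrite /= msym_var a2.
- by rewrite /= msym_var a3.
- by rewrite /= msym_var a4.
- have msym3 (p q r : 'S_m) : msym r (msym q (msym p f)) = msym (p * q * r)%g f.
    by rewrite !msymMm.
  apply: etrans (msym3 _ _ _) _; apply: etrans _ (esym (msym3 _ _ _)).
  by rewrite (simple_braid ij).
Qed.

End DemazureRelations.

(** * Products over pairs of small total weight *)

Section WeightedProducts.
Variable m : nat.
Local Open Scope ring_scope.
Implicit Types (e : 'I_m -> nat) (i j : 'I_m.-1) (x y c : 'I_m).

(** With the weight [x + 1] and the bound [m] this is the polynomial of the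
    longest element; paths are followed by modifying the weight only. *)
Definition weighted_product (t : nat) e : {mpoly int[m]} :=
  \prod_(x < m) \prod_(y < m | (x < y)%N && (e x + e y <= t)%N) (1 - 'X_x * 'X_y).

Lemma weighted_productE t e :
  weighted_product t e =
  \prod_(xy : 'I_m * 'I_m | (xy.1 < xy.2)%N && (e xy.1 + e xy.2 <= t)%N)
    (1 - 'X_xy.1 * 'X_xy.2).
Proof. by rewrite /weighted_product pair_big_dep. Qed.

(** The reflection permutes the factors.  Pairs [x < y] stay in increasing order
    except for the pair of swapped positions, whose factor is invariant; the
    reindexing [flip] therefore leaves that pair alone. *)
Lemma msym_weighted_product t e i :
  e (lo i) = e (hi i) -> msym (simple i) (weighted_product t e) = weighted_product t e.
Proof.
move=> eh; have es x : e (simple i x) = e x.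
  by rewrite /simple; case: tpermP => [->|->|].
pose sw (xy : 'I_m * 'I_m) := (simple i xy.1, simple i xy.2).
(* The pair of swapped positions, in both orders: [flip] must be an involution. *)
pose crit := [:: (lo i, hi i); (hi i, lo i)].
pose flip xy := if xy \in crit then xy else sw xy.
have swK : involutive sw by move=> [x y]; rewrite /sw /= !simple_inv.
have sw_crit xy : (sw xy \in crit) = (xy \in crit).
  case: xy => x y; rewrite !inE !xpair_eqE /=.
  by rewrite !(can2_eq (simple_inv i) (simple_inv i)) simple_lo simple_hi orbC.
have flipK : involutive flip.
  move=> xy; rewrite /flip; have [c|nc] := boolP (xy \in crit).
    by rewrite c.
  by rewrite sw_crit (negPf nc) swK.
have sw_lt x y : (x, y) \notin crit -> (simple i x < simple i y)%N = (x < y)%N.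
  move=> nc; have nl : (x, y) != (lo i, hi i).
    by apply: contra nc; rewrite !inE => ->.
  have nl' : (simple i x, simple i y) != (lo i, hi i).
    rewrite -[(_, _)]/(sw (x, y)); apply: contra nc.
    by rewrite -sw_crit !inE => ->.
  apply/idP/idP => lt; last exact: simple_mono.
  by have := simple_mono lt nl'; rewrite !simple_inv.
rewrite weighted_productE rmorph_prod (reindex_inj (inv_inj flipK)) /=.
apply: eq_big => [[x y]|[x y] _].
  rewrite /flip; case: ifPn => //= nc.
  by rewrite (sw_lt _ _ nc) !es.
rewrite rmorphB rmorph1 rmorphM /= !msym_var /flip.
case: ifPn => /= [|_]; last by rewrite !simple_inv.
rewrite !inE => /orP[]/eqP[-> ->]; rewrite simple_lo simple_hi //;
  by rewrite [_ * 'X_(lo i)]mulrC.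
Qed.

Lemma demazure_one_sub i c : c != lo i -> c != hi i ->
  demazure i (1 - 'X_(lo i) * 'X_c) = 1.
Proof.
move=> cl ch; apply: demazure_unique.
rewrite rmorphB rmorph1 rmorphM /= !msym_var simple_lo simple_fix //.
by ring.
Qed.

Definition raise e i x : nat := if x == lo i then e (hi i) else e x.

(** Raising the weight of [lo i] by one excludes the pairs that contain [lo i] and
    have total weight exactly [t]; [c] is by hypothesis the only partner in such
    a pair. *)
Lemma weighted_product_raise t e i c :
    e (hi i) = (e (lo i)).+1 -> c != lo i ->
    (forall x, x != lo i -> (e (lo i) + e x == t)%N = (x == c)) ->
  weighted_product t e =
  weighted_product t (raise e i) * (1 - 'X_(lo i) * 'X_c).
Proof.
rewrite /raise; move: (lo i) => a eh cl tc.
have tca : (e a + e c)%N = t by apply/eqP; rewrite tc.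
pose p0 : 'I_m * 'I_m := if (a < c)%N then (a, c) else (c, a).
have ca : (a < c)%N || (c < a)%N by rewrite -neq_ltn eq_sym.
rewrite !weighted_productE mulrC (bigD1 p0) /=; last first.
  by move: ca; rewrite /p0; case: ifP => /= [-> _|_ ->]; rewrite ?tca 1?addnC ?tca leqnn.
congr (_ * _).
  by rewrite /p0; case: ifP => //= _; rewrite mulrC.
apply: eq_bigl => -[x y] /=; have [xy|] //= := boolP (x < y)%N.
have -> : ((x, y) == p0) = ((x == a) && (y == c)) || ((x == c) && (y == a)).
  by rewrite /p0; case: ifP => ac; rewrite !xpair_eqE -!val_eqE /=; lia.
have [xa|xa] /= := eqVneq x a.
  have ya : y != a by rewrite -xa -val_eqE /=; lia.
  by rewrite (negPf ya) andbF orbF xa -(tc _ ya) eh; lia.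
have [ya|ya] /= := eqVneq y a; last by rewrite andbF andbT.
by rewrite ya andbT -(tc _ xa) eh; lia.
Qed.

(** After the raise, [lo i] and [hi i] have equal weights, so all factors but the
    deleted one form a product that is symmetric and comes out of the operator,
    which sends the deleted factor to 1. *)
Lemma demazure_weighted_product t e i c :
    e (hi i) = (e (lo i)).+1 -> c != lo i -> c != hi i ->
    (forall x, x != lo i -> (e (lo i) + e x == t)%N = (x == c)) ->
  demazure i (weighted_product t e) = weighted_product t (raise e i).
Proof.
move=> eh cl ch tc; rewrite (weighted_product_raise eh cl tc).
rewrite demazure_symM ?demazure_one_sub ?mulr1 //.
by apply: msym_weighted_product; rewrite /raise eqxx; case: eqP.
Qed.

Lemma UpsilonK_w0E : UpsilonK_w0 m = weighted_product m (fun x => x.+1).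
Proof. by []. Qed.

(** Both operators delete the factor that pairs [lo i] with [lo j]. *)
Lemma demazure_w0_mirror i j : (i + j).+2 = m -> i.+1 != j -> j.+1 != i ->
  demazure i (UpsilonK_w0 m) = demazure j (UpsilonK_w0 m).
Proof.
move=> ijm n1 n2; rewrite UpsilonK_w0E.
have cond (k l : 'I_m.-1) : (k + l).+2 = m -> forall x : 'I_m, x != lo k ->
    ((lo k).+1 + x.+1 == m)%N = (x == lo l).
  by move=> klm x _; rewrite -val_eqE /=; lia.
have jim : (j + i).+2 = m by rewrite addnC.
have [->//|nij] := eqVneq i j.
have nl (k l : 'I_m.-1) : k != l -> lo k != lo l by rewrite -!val_eqE.
have nh (k l : 'I_m.-1) : l.+1 != k -> lo k != hi l by rewrite -!val_eqE /= eq_sym.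
rewrite (demazure_weighted_product _ (nl _ _ _) (nh _ _ n1) (cond i j ijm)) 1?eq_sym //.
rewrite (demazure_weighted_product _ (nl _ _ _) (nh _ _ n2) (cond j i jim)) //.
apply: eq_bigr => x _; apply: eq_bigl => y; rewrite /raise -!val_eqE /=.
move: nij; rewrite -val_eqE /= => nij.
by repeat case: ifPn; lia.
Qed.

End WeightedProducts.

(** * Weak order on fixed-point-free involutions *)

Section WeakOrder.
Variable m : nat.
Implicit Types (i j k : 'I_m.-1) (x y : 'I_m) (p q : 'S_m) (f g : {mpoly int[m]}).

Lemma fpf_invol p : p \in fpf_involutions m -> involutive p.
Proof. by rewrite inE => /andP[/eqP pp _] x; rewrite -permM pp perm1. Qed.

Lemma fpf_neq p x : p \in fpf_involutions m -> p x != x.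
Proof. by rewrite inE => /andP[_ /forallP]. Qed.

Lemma fpfP p : involutive p -> (forall x, p x != x) -> p \in fpf_involutions m.
Proof.
move=> pK pF; rewrite inE; apply/andP; split; last exact/forallP.
by apply/eqP/permP=> x; rewrite permM perm1 pK.
Qed.

Lemma conj_simpleE i p x : conj_simple i p x = simple i (p (simple i x)).
Proof. by rewrite /conj_simple !permM. Qed.

Lemma conj_simpleK i : involutive (@conj_simple m i).
Proof. by move=> p; apply/permP=> x; rewrite !conj_simpleE !simple_inv. Qed.

Lemma fpf_conj i p : p \in fpf_involutions m -> conj_simple i p \in fpf_involutions m.
Proof.
move=> fp; apply: fpfP => x; rewrite !conj_simpleE.
  by rewrite simple_inv (fpf_invol fp) simple_inv.
by rewrite (can2_eq (simple_inv i) (simple_inv i)) fpf_neq.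
Qed.

Definition ascent i p := p (lo i) < p (hi i).

(** Without fixed-point-freeness the values of [p] at the two positions could be
    these positions themselves, and conjugation would not change [p]. *)
Lemma ascent_conj_desc i p : p \in fpf_involutions m -> ascent i p ->
  conj_simple i p (hi i) < conj_simple i p (lo i).
Proof.
move=> fp ap; rewrite !conj_simpleE simple_lo simple_hi.
by apply: simple_mono => //; rewrite xpair_eqE negb_and fpf_neq.
Qed.

Lemma invset_conj i p : p \in fpf_involutions m -> ascent i p ->
  #|invset (conj_simple i p)| = #|invset p|.+2.
Proof.
move=> fp ap; set q := conj_simple i p.
have fq : q \in fpf_involutions m by exact: fpf_conj.
have qV : (q^-1 = q)%g.
  by apply/permP=> x; apply: (@perm_inj _ q); rewrite permKV (fpf_invol fq).
rewrite (invset_down (ascent_conj_desc fp ap)) -invsetV invMg qV tpermV.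
by rewrite -/(simple i) /q /conj_simple -mulgA simpleK mulg1 (invset_up ap).
Qed.

Lemma act_moved i p q : p \in fpf_involutions m -> Defs.act i q = p -> p != q ->
  conj_simple i p = q /\ ascent i p.
Proof.
rewrite /Defs.act; case: ifPn => [_ _ <-|]; first by rewrite eqxx.
rewrite negb_or => /andP[long _] fp qp pq; have pK : conj_simple i p = q.
  by rewrite -qp conj_simpleK.
split=> //; rewrite /ascent; case/orP: (simple_lt_or p i) => // desc.
case/negP: long; rewrite !coxeter_lengthE.
have fq : q \in fpf_involutions m by rewrite -pK fpf_conj.
have qV : (q^-1 = q)%g.
  by apply/permP=> x; apply: (@perm_inj _ q); rewrite permKV (fpf_invol fq).
rewrite -[X in _ < X]invsetV /lmul_simple invMg qV tpermV -/(simple i) invset_up //.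
rewrite -pK !conj_simpleE simple_lo simple_hi simple_mono //.
apply: contra pq; rewrite xpair_eqE => /andP[/eqP e1 /eqP e2].
rewrite -pK; apply/eqP/permP=> x; rewrite conj_simpleE.
have [->|nl] := eqVneq x (lo i); first by rewrite simple_lo e1 simple_lo e2.
have [->|nh] := eqVneq x (hi i); first by rewrite simple_hi e2 simple_hi e1.
rewrite (simple_fix nl nh) simple_fix //.
  by rewrite -e1 (inj_eq perm_inj).
by rewrite -e2 (inj_eq perm_inj).
Qed.

(** Read from its endpoint upwards, a labelled path chooses at each element an
    ascent and moves to the conjugate; the top of the order is [w0]. *)
Inductive path_value : 'S_m -> {mpoly int[m]} -> Prop :=
| TopValue : path_value (w0 m) (UpsilonK_w0 m)
| StepValue i p f of p \in fpf_involutions m & ascent i p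
    & path_value (conj_simple i p) f : path_value p (demazure i f).

Lemma labelled_path_value w p : p \in fpf_involutions m -> labelled_path w p ->
  path_value p (demazure_word w (UpsilonK_w0 m)).
Proof.
rewrite /labelled_path; elim: w p => [|i w IH] p fp /=.
  by move=> /eqP <-; apply: TopValue.
rewrite -/(act_word w) -/(demazure_word w _) => /andP[/andP[mv paths] /eqP e].
rewrite e in mv; have [c ap] := act_moved fp e mv.
apply: StepValue => //; rewrite c; apply: IH; last by rewrite paths eqxx.
by rewrite -c fpf_conj.
Qed.

Lemma w0_not_ascent i : ~~ ascent i (w0 m).
Proof. by rewrite /ascent !permE /=; lia. Qed.

(** The arcs [lo i -- hi j] and [hi i -- lo j] of the matching [p]. *)
Definition nested i j p := (p (lo i) == hi j) && (p (hi i) == lo j).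

Definition far i j := (i.+1 < j) || (j.+1 < i).

Lemma farC i j : far i j = far j i.
Proof. by rewrite /far orbC. Qed.

Lemma far_fix i j : far i j -> simple i (lo j) = lo j /\ simple i (hi j) = hi j.
Proof. by rewrite /far => ij; split; apply: simple_fix; rewrite -val_eqE /=; lia. Qed.

Lemma far_demazure i j f : far i j ->
  demazure i (demazure j f) = demazure j (demazure i f).
Proof. by case/orP=> ij; [|symmetry]; apply: demazure_comm. Qed.

Lemma far_conj i j p : far i j ->
  conj_simple i (conj_simple j p) = conj_simple j (conj_simple i p).
Proof.
have comm (k l : 'I_m.-1) : k.+1 < l ->
    conj_simple k (conj_simple l p) = conj_simple l (conj_simple k p).
  move=> /simple_comm; rewrite /commute => kl; rewrite /conj_simple !mulgA kl.
  by rewrite -!mulgA kl.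
by case/orP=> ij; [|symmetry]; apply: comm.
Qed.

Lemma adjacent_demazure i j f : (j == i.+1 :> nat) || (i == j.+1 :> nat) ->
  demazure i (demazure j (demazure i f)) = demazure j (demazure i (demazure j f)).
Proof. by case/orP=> /eqP ij; [|symmetry]; apply: demazure_braid. Qed.

Lemma braid_conj i j p : j = i.+1 :> nat ->
  conj_simple i (conj_simple j (conj_simple i p)) =
  conj_simple j (conj_simple i (conj_simple j p)).
Proof.
move=> /simple_braid b; rewrite /conj_simple.
have -> : (simple i * (simple j * (simple i * p * simple i) * simple j) * simple i
  = (simple i * simple j * simple i) * p * (simple i * simple j * simple i))%g.
  by rewrite !mulgA.
by rewrite b !mulgA.
Qed.

Lemma nestedC i j p : p \in fpf_involutions m -> nested i j p = nested j i p.
Proof.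
move=> /fpf_invol pK; rewrite /nested !(can2_eq pK pK (lo i)) !(can2_eq pK pK (hi i)).
by rewrite andbC ![_ == p _]eq_sym.
Qed.

(** * Independence of the labelled path *)

Lemma path_value_exists p : p \in fpf_involutions m -> exists f, path_value p f.
Proof.
move=> fp; have [w pw] := labelled_path_exists fp.
by exists (demazure_word w (UpsilonK_w0 m)); apply: labelled_path_value.
Qed.

Lemma path_value_inv p f : path_value p f ->
  p = w0 m /\ f = UpsilonK_w0 m \/
  exists i g, [/\ ascent i p, path_value (conj_simple i p) g & f = demazure i g].
Proof. by case=> [|i q g _ aq vg]; [left | right; exists i, g]. Qed.

(** The number of inversions grows by two at each step towards [w0]. *)
Definition height p := #|{: 'I_m * 'I_m}| - #|invset p|.

Lemma height_conj i p : p \in fpf_involutions m -> ascent i p ->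
  height (conj_simple i p) < height p.
Proof.
move=> fp ap.
have : #|invset (conj_simple i p)| <= #|{: 'I_m * 'I_m}| by exact: max_card.
by rewrite /height (invset_conj fp ap); lia.
Qed.

Definition coherent p := forall f g, path_value p f -> path_value p g -> f = g.

(** Conjugation by the two ends of a nested pair gives the same element, so this
    is the comparison of two paths whose last letters are [i] and [j]. *)
Definition mirrored p := forall i j f,
  far i j -> nested i j p -> path_value p f -> demazure i f = demazure j f.

(** Moving up by [k] and then [i] slides the end of the nested pair at [i]
    to [k]: for [k = i + 1] the values of [p] at [i, i + 1, i + 2]
    are [j + 1, j, c] with [c > j + 1], and become [c, j + 1, j]; the case
    [i = k + 1] is the mirror image. *)
Lemma nested_adjacent i j k p : p \in fpf_involutions m -> far i j ->
    nested i j p -> (k == i.+1 :> nat) || (i == k.+1 :> nat) -> ascent k p ->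
  [/\ far k j, ascent i (conj_simple k p)
    & nested k j (conj_simple i (conj_simple k p))].
Proof.
move=> fp ij nij ik ak; have pK := fpf_invol fp.
have /andP[/eqP e1 /eqP e2] := nij.
have e3 : p (hi j) = lo i by rewrite -e1 pK.
have e4 : p (lo j) = hi i by rewrite -e2 pK.
have kj : far k j.
  move: ak ij; rewrite /ascent /far; case/orP: ik => /eqP ik.
    have -> : lo k = hi i by apply: val_inj; rewrite /= ik.
    have [kj|] := eqVneq (j : nat) k.+1; last by lia.
    have -> : hi k = lo j by apply: val_inj; rewrite /= kj.
    by rewrite e2 e4 /=; lia.
  have -> : hi k = lo i by apply: val_inj; rewrite /= ik.
  have [kj|] := eqVneq (k : nat) j.+1; last by lia.
  have -> : lo k = hi j by apply: val_inj; rewrite /= kj.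
  by rewrite e1 e3 /=; lia.
have [ijl ijh] := far_fix ij; have [kjl kjh] := far_fix kj.
have pinj := @perm_inj _ p.
split=> //; case/orP: ik => /eqP ik.
- have h : lo k = hi i by apply: val_inj; rewrite /= ik.
  have s1 : simple k (lo i) = lo i by apply: simple_fix; rewrite -val_eqE /=; lia.
  have s2 : simple k (p (hi k)) = p (hi k).
    apply: simple_fix; last exact: fpf_neq.
    rewrite (can2_eq pK pK) h e2; move: kj; rewrite -val_eqE /far /=; lia.
  rewrite /ascent !conj_simpleE s1 e1 kjh -h simple_lo s2.
  have : p (hi k) != hi j by rewrite -e1 (inj_eq pinj) -val_eqE /=; lia.
  by move: ak; rewrite /ascent h e2 -val_eqE /=; lia.
- have h : hi k = lo i by apply: val_inj; rewrite /= ik.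
  have s1 : simple k (hi i) = hi i by apply: simple_fix; rewrite -val_eqE /=; lia.
  have s2 : simple k (p (lo k)) = p (lo k).
    apply: simple_fix; first exact: fpf_neq.
    rewrite (can2_eq pK pK) h e1; move: kj; rewrite -val_eqE /far /=; lia.
  rewrite /ascent !conj_simpleE s1 e2 kjl -h simple_hi s2.
  have : p (lo k) != lo j by rewrite -e2 (inj_eq pinj) -val_eqE /=; lia.
  by move: ak; rewrite /ascent h e1 -val_eqE /=; lia.
- have h : lo k = hi i by apply: val_inj; rewrite /= ik.
  have s1 : simple k (lo i) = lo i by apply: simple_fix; rewrite -val_eqE /=; lia.
  have s2 : simple i (hi k) = hi k by apply: simple_fix; rewrite -val_eqE /=; lia.
  rewrite /nested !conj_simpleE s2 simple_hi h simple_hi s1 e1 e2.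
  by rewrite kjh ijh kjl ijl !eqxx.
- have h : hi k = lo i by apply: val_inj; rewrite /= ik.
  have s1 : simple k (hi i) = hi i by apply: simple_fix; rewrite -val_eqE /=; lia.
  have s2 : simple i (lo k) = lo k by apply: simple_fix; rewrite -val_eqE /=; lia.
  rewrite /nested !conj_simpleE s2 simple_lo h simple_lo s1 e1 e2.
  by rewrite kjh ijh kjl ijl !eqxx.
Qed.

Lemma mirrored_step p : p \in fpf_involutions m -> coherent p ->
    (forall q, q \in fpf_involutions m -> height q < height p -> mirrored q) ->
  mirrored p.
Proof.
move=> fp cp IH i j f ij nij vf.
(* Stated for [i'] and [j'] so as to cover the ascents adjacent to [j] too. *)
have adjacent k i' j' : far i' j' -> nested i' j' p ->
    (k == i'.+1 :> nat) || (i' == k.+1 :> nat) -> ascent k p ->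
    demazure i' f = demazure j' f.
  move=> ij' nij' ik ak; have [kj ai nkj] := nested_adjacent fp ij' nij' ik ak.
  set q := conj_simple k p in ai nkj; set q' := conj_simple i' q in nkj.
  have fq : q \in fpf_involutions m by exact: fpf_conj.
  have fq' : q' \in fpf_involutions m by exact: fpf_conj.
  have [r vr] := path_value_exists fq'.
  have hq : height q' < height p.
    by apply: ltn_trans (height_conj fq ai) (height_conj fp ak).
  have -> : f = demazure k (demazure i' r).
    by apply: (cp) => //; apply: StepValue => //; apply: StepValue.
  apply: etrans (adjacent_demazure r ik) _; rewrite (IH _ fq' hq _ _ _ kj nkj vr).
  apply: etrans (congr1 _ (far_demazure r ij')) _; exact: (far_demazure _ kj).
have [[ep ->]|[k [g [ak vg ef]]]] := path_value_inv vf.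
  have := nij; rewrite ep /nested -!val_eqE !permE /= => /andP[/eqP e _].
  apply: demazure_w0_mirror; move: ij; rewrite /far; have := ltn_ord i; lia.
have [e1 e2] : p (lo i) = hi j /\ p (hi i) = lo j.
  by have /andP[/eqP ? /eqP ?] := nij.
have nji : nested j i p by rewrite -nestedC.
have ji : far j i by rewrite farC.
have [ik|ik] := boolP ((k == i.+1 :> nat) || (i == k.+1 :> nat)).
  exact: (adjacent k).
have [jk|jk] := boolP ((k == j.+1 :> nat) || (j == k.+1 :> nat)).
  by symmetry; apply: (adjacent k).
have nki : k != i by apply: contraTneq ak => ->; rewrite /ascent e1 e2 /=; lia.
have nkj : k != j.
  apply: contraTneq ak => ->; rewrite /ascent.
  by have /andP[/eqP -> /eqP ->] := nji; rewrite /=; lia.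
have ki : far k i by move: nki ik; rewrite /far -val_eqE /=; lia.
have kj : far k j by move: nkj jk; rewrite /far -val_eqE /=; lia.
have [kil kih] := far_fix ki; have [kjl kjh] := far_fix kj.
have mid : demazure i g = demazure j g.
  apply: (IH (conj_simple k p)) => //; [exact: fpf_conj|exact: height_conj|].
  by rewrite /nested !conj_simpleE kil kih e1 e2 kjl kjh !eqxx.
rewrite ef; apply: etrans (esym (far_demazure g ki)) _; rewrite mid.
exact: far_demazure.
Qed.

(** The values of [p] at the positions [i, i + 1, i + 2] are increasing and avoid
    these positions: a value among them would force a second one, and the two
    would form a descent.  Hence conjugation only permutes the three values, and
    the three-step conjugates along both sides of the hexagon agree. *)
Lemma hexagon i j p g h : p \in fpf_involutions m -> j = i.+1 :> nat ->
    ascent i p -> ascent j p ->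
    coherent (conj_simple i p) -> coherent (conj_simple j p) ->
    path_value (conj_simple i p) g -> path_value (conj_simple j p) h ->
  demazure i g = demazure j h.
Proof.
move=> fp ij ai aj ci cj vg vh; have pK := fpf_invol fp.
have hl : lo j = hi i by apply: val_inj; rewrite /= ij.
have sl : simple j (lo i) = lo i by apply: simple_fix; rewrite -val_eqE /=; lia.
have sh : simple i (hi j) = hi j by apply: simple_fix; rewrite -val_eqE /=; lia.
have sj_lo := simple_lo j; have sj_hi := simple_hi j.
have ac := ai; have bc := aj; rewrite /ascent hl in ac bc; rewrite hl in sj_lo sj_hi.
have nfix x y : p x = y -> p y = x by move=> <-; rewrite pK.
have [na nb nc] : [/\ p (lo i) != hi i, p (lo i) != hi j & p (hi i) != hi j].
  split; apply/eqP=> e; have e' := nfix _ _ e.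
  - by move: ac; rewrite e e' /=; lia.
  - by move: (ltn_trans ac bc); rewrite e e' /=; lia.
  - by move: bc; rewrite e e' /=; lia.
have [na' nb' nc'] : [/\ p (hi i) != lo i, p (hi j) != lo i & p (hi j) != hi i].
  by split; rewrite (can2_eq pK pK) eq_sym.
have [da db dc] : [/\ p (lo i) != lo i, p (hi i) != hi i & p (hi j) != hi j].
  by split; apply: fpf_neq.
have [ia ib ic] : [/\ simple i (p (lo i)) = p (lo i), simple i (p (hi i)) = p (hi i)
    & simple i (p (hi j)) = p (hi j)] by split; apply: simple_fix.
have [ja jb jc] : [/\ simple j (p (lo i)) = p (lo i), simple j (p (hi i)) = p (hi i)
    & simple j (p (hi j)) = p (hi j)] by split; apply: simple_fix; rewrite ?hl.
pose q1 := conj_simple i p; pose q2 := conj_simple j q1.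
pose r1 := conj_simple j p; pose r2 := conj_simple i r1.
have simp := (conj_simpleE, simple_lo i, simple_hi i, sj_lo, sj_hi, sl, sh,
  ia, ib, ic, ja, jb, jc).
have aq1 : ascent j q1 by rewrite /ascent hl /q1 !simp (ltn_trans ac bc).
have aq2 : ascent i q2 by rewrite /ascent /q2 /q1 !simp.
have ar1 : ascent i r1 by rewrite /ascent /r1 !simp (ltn_trans ac bc).
have ar2 : ascent j r2 by rewrite /ascent hl /r2 /r1 !simp.
have fq1 : q1 \in fpf_involutions m by exact: fpf_conj.
have fq2 : q2 \in fpf_involutions m by exact: fpf_conj.
have fr1 : r1 \in fpf_involutions m by exact: fpf_conj.
have fr2 : r2 \in fpf_involutions m by exact: fpf_conj.
have [f vf] := path_value_exists (fpf_conj i fq2).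
have eqr : conj_simple i q2 = conj_simple j r2 by exact: braid_conj.
have -> : g = demazure j (demazure i f).
  by apply: ci => //; apply: StepValue => //; apply: StepValue.
have -> : h = demazure i (demazure j f).
  by apply: cj => //; apply: StepValue => //; apply: StepValue => //; rewrite -eqr.
exact: demazure_braid.
Qed.

Lemma parallel_conj i j p : p \in fpf_involutions m -> far i j ->
  p (lo i) = lo j -> p (hi i) = hi j -> conj_simple i p = conj_simple j p.
Proof.
move=> fp ij e1 e2.
have sp : (simple i * p = p * simple j)%g.
  by rewrite conjgC /simple tpermJ e1 e2.
have ps : (simple j * p = p * simple i)%g.
  by rewrite conjgC /simple tpermJ -e1 -e2 !(fpf_invol fp).
have comm : (simple i * simple j = simple j * simple i)%g.
  by case/orP: ij => /simple_comm.
by rewrite /conj_simple sp ps -!mulgA comm.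
Qed.

(** The ascent [j] survives conjugation by [s_i] unless the values at [lo j] and
    [hi j] are exactly [lo i] and [hi i]; in that case both conjugates coincide
    and are nested at [i, j]. *)
Lemma square i j p g h : p \in fpf_involutions m -> far i j ->
    ascent i p -> ascent j p ->
    coherent (conj_simple i p) -> coherent (conj_simple j p) ->
    mirrored (conj_simple i p) ->
    path_value (conj_simple i p) g -> path_value (conj_simple j p) h ->
  demazure i g = demazure j h.
Proof.
move=> fp ij ai aj ci cj mi vg vh; have pK := fpf_invol fp.
have ji : far j i by rewrite farC.
have [ijl ijh] := far_fix ij; have [jil jih] := far_fix ji.
have [/andP[/eqP e1 /eqP e2]|np] := boolP ((p (lo i) == lo j) && (p (hi i) == hi j)).
  rewrite -(parallel_conj fp ij e1 e2) in vh; rewrite (ci _ _ vh vg).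
  apply: (mi) => //.
  by rewrite /nested !conj_simpleE simple_lo simple_hi e1 e2 ijl ijh !eqxx.
have aij : ascent j (conj_simple i p).
  rewrite /ascent !conj_simpleE ijl ijh; apply: simple_mono => //.
  by rewrite xpair_eqE !(can2_eq pK pK) ![lo j == _]eq_sym ![hi j == _]eq_sym.
have aji : ascent i (conj_simple j p).
  by rewrite /ascent !conj_simpleE jil jih; apply: simple_mono.
have fi := fpf_conj i fp; have fj := fpf_conj j fp.
have [f vf] := path_value_exists (fpf_conj j fi).
have -> : g = demazure j f by apply: ci => //; apply: StepValue.
have -> : h = demazure i f.
  by apply: cj => //; apply: StepValue => //; rewrite (far_conj _ ij).
exact: far_demazure.
Qed.

(** Independence at [p] uses the mirror identity strictly above [p], while the
    mirror identity at [p] uses independence at [p] itself, so the two are proved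
    together. *)
Theorem path_value_coherent p : p \in fpf_involutions m -> coherent p /\ mirrored p.
Proof.
move: {2}(height p).+1 (ltnSn (height p)) => n.
elim: n p => [p|n IHn p hp fp]; first by rewrite ltn0.
have IH i : ascent i p -> coherent (conj_simple i p) /\ mirrored (conj_simple i p).
  move=> ai; apply: IHn; last exact: fpf_conj.
  exact: leq_trans (height_conj fp ai) hp.
have cp : coherent p.
  move=> f f' vf vf'.
  have [[ep ef]|[i [g [ai vg ef]]]] := path_value_inv vf;
  have [[ep' ef']|[j [h [aj vh ef']]]] := path_value_inv vf'.
  - by rewrite ef ef'.
  - by move: aj; rewrite ep (negPf (w0_not_ascent _)).
  - by move: ai; rewrite ep' (negPf (w0_not_ascent _)).
  rewrite ef ef'.
  have [ci mi] := IH i ai; have [cj mj] := IH j aj.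
  have [ij|ij] := eqVneq i j.
    by rewrite -ij in vh *; congr demazure; apply: ci.
  have [/eqP ij1|ij1] := boolP (j == i.+1 :> nat).
    exact: (hexagon fp ij1 ai aj ci cj vg vh).
  have [/eqP ji1|ji1] := boolP (i == j.+1 :> nat).
    exact: (esym (hexagon fp ji1 aj ai cj ci vh vg)).
  have fij : far i j by move: ij; rewrite /far -val_eqE /=; lia.
  exact: (square fp fij ai aj ci cj mi vg vh).
split; first exact: cp.
apply: (mirrored_step fp cp) => q fq hq.
by have [_ mq] := IHn q (leq_trans hq hp) fq.
Qed.

End WeakOrder.

(** * Embedding into more variables *)

(** Integer coefficients are preserved by every ring morphism. *)
Lemma mpoly_int_rmorph_eq m (R : comNzRingType) (f g : {rmorphism {mpoly int[m]} -> R}) :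
  (forall x, f 'X_x = g 'X_x) -> f =1 g.
Proof.
move=> fgX; elim/mpolyind => [|c k p _ _ IH]; first by rewrite !rmorph0.
rewrite !rmorphD IH -mul_mpolyC -[c]intz rmorph_int !rmorphM !rmorph_int.
congr (_ * _ + _)%R; rewrite mpolyXE_id !rmorph_prod.
by apply: eq_bigr => x _; rewrite !rmorphXn /= fgX.
Qed.

Section Widening.
Variables (n N : nat) (leN : n <= N).
Notation wide := (widen_ord (le_double leN)).

Lemma wide_inj : injective wide.
Proof. by move=> x y /(congr1 val) /= /val_inj. Qed.

Lemma wide_index_subproof (i : 'I_n.*2.-1) : i < N.*2.-1.
Proof. by have := ltn_ord i; have := le_double leN; lia. Qed.

Definition wide_index (i : 'I_n.*2.-1) : 'I_N.*2.-1 := Ordinal (wide_index_subproof i).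

Lemma lo_wide i : lo (wide_index i) = wide (lo i).
Proof. exact: val_inj. Qed.

Lemma hi_wide i : hi (wide_index i) = wide (hi i).
Proof. exact: val_inj. Qed.

Lemma simple_wide i x : simple (wide_index i) (wide x) = wide (simple i x).
Proof. by apply: val_inj; rewrite /= !val_simple. Qed.

Lemma simple_wide_high i (x : 'I_N.*2) : n.*2 <= x -> simple (wide_index i) x = x.
Proof.
by move=> hx; have := ltn_ord i; move=> ?; apply: simple_fix; rewrite -val_eqE /=; lia.
Qed.

Lemma iota_wide p x : iota_fpf leN p (wide x) = wide (p x).
Proof.
rewrite permE; case: iotaP => [y /wide_inj <- //|/= h].
by have := ltn_ord x; lia.
Qed.

Lemma iota_high p (x : 'I_N.*2) : n.*2 <= x ->
  iota_fpf leN p x = partner leN x /\ n.*2 <= partner leN x.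
Proof.
rewrite permE; case: iotaP => [y -> /=|//].
by have := ltn_ord y; lia.
Qed.

Lemma wideP (x : 'I_N.*2) : (exists y, x = wide y) \/ n.*2 <= x.
Proof.
have [h|h] := ltnP x n.*2; [left | by right].
by exists (Ordinal h); apply: val_inj.
Qed.

Lemma iota_conj i p :
  iota_fpf leN (conj_simple i p) = conj_simple (wide_index i) (iota_fpf leN p).
Proof.
apply/permP=> x; rewrite conj_simpleE; have [[y ->]|hx] := wideP x.
  by rewrite simple_wide !iota_wide simple_wide conj_simpleE.
rewrite (simple_wide_high i hx).
have [-> hp] := iota_high p hx; have [-> _] := iota_high (conj_simple i p) hx.
by rewrite simple_wide_high.
Qed.

Lemma iota_ascent i p : ascent (wide_index i) (iota_fpf leN p) = ascent i p.
Proof. by rewrite /ascent lo_wide hi_wide !iota_wide. Qed.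

Local Open Scope ring_scope.

Lemma widen_varE x : widen_vars leN 'X_x = 'X_(wide x).
Proof. by rewrite /widen_vars /comp_mpoly mmapX mmap1U tnth_mktuple. Qed.

Lemma widen_msym i f :
  widen_vars leN (msym (simple i) f) =
  msym (simple (wide_index i)) (widen_vars leN f).
Proof.
pose W := comp_mpoly [tuple 'X_(wide x) : {mpoly int[N.*2]} | x < n.*2].
apply: (mpoly_int_rmorph_eq (f := W \o msym (simple i))
  (g := msym (simple (wide_index i)) \o W)) => x /=.
by rewrite msym_var -!/(widen_vars leN _) !widen_varE msym_var simple_wide.
Qed.

Lemma widen_demazure i f :
  widen_vars leN (demazure i f) = demazure (wide_index i) (widen_vars leN f).
Proof.
symmetry; apply: demazure_unique; rewrite lo_wide hi_wide -widen_msym -!widen_varE.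
have := congr1 (widen_vars leN) (demazureE i f).
by rewrite /widen_vars !(rmorphB, rmorphM).
Qed.

(** Conjugations, ascents and Demazure operators commute with the embedding, so
    only the top element has to be treated. *)
Lemma path_value_widen :
    path_value (iota_fpf leN (w0 n.*2)) (widen_vars leN (UpsilonK_w0 n.*2)) ->
  forall p f, path_value p f -> path_value (iota_fpf leN p) (widen_vars leN f).
Proof.
move=> top p f; elim=> {p f} [|i p f fp ap _ IH]; first exact: top.
rewrite widen_demazure; apply: StepValue; last by rewrite -iota_conj.
  exact: iota_fpf_in.
by rewrite iota_ascent.
Qed.

Lemma widen_UpsilonK_w0 :
  widen_vars leN (UpsilonK_w0 n.*2) =
  \prod_(x < N.*2) \prod_(y < N.*2 |
     (x < y)%N && (x.+1 + y.+1 <= n.*2)%N) (1 - 'X_x * 'X_y).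
Proof.
rewrite /widen_vars rmorph_prod.
rewrite [RHS](bigID (fun x : 'I_N.*2 => x < n.*2)%N) /=.
rewrite [X in _ * X]big1 ?mulr1; last first.
  by move=> x hx; rewrite big_pred0 // => y; lia.
rewrite (big_ord_narrow (le_double leN)).
apply: eq_bigr => x _; rewrite rmorph_prod.
transitivity (\prod_(y < N.*2 | ((x < y)%N && (x.+1 + y.+1 <= n.*2)%N) && (y < n.*2)%N)
   (1 - 'X_(wide x) * 'X_y) : {mpoly int[N.*2]}).
  rewrite (big_ord_narrow_cond (le_double leN)); apply: eq_bigr => y _.
  have wX := widen_varE; rewrite /widen_vars in wX.
  by rewrite rmorphB rmorph1 rmorphM /= !wX.
by apply: eq_bigl => y /=; lia.
Qed.

End Widening.

Lemma iota_refl n (le_nn : n <= n) p : iota_fpf le_nn p = p.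
Proof.
apply/permP=> x; have -> : x = widen_ord (le_double le_nn) x by exact: val_inj.
by rewrite iota_wide; apply: val_inj; rewrite /=; congr (val (p _)); apply: val_inj.
Qed.

Lemma widen_refl n (le_nn : n <= n) f : widen_vars le_nn f = f.
Proof.
apply: (mpoly_int_rmorph_eq (f := comp_mpoly _) (g := idfun)) => x /=.
by rewrite -/(widen_vars le_nn _) widen_varE; congr (mpolyX _ U_(_)); apply: val_inj.
Qed.

Lemma iota_trans n N M (leN : n <= N) (leM : N <= M) (le : n <= M) p :
  iota_fpf leM (iota_fpf leN p) = iota_fpf le p.
Proof.
have ww x : widen_ord (le_double leM) (widen_ord (le_double leN) x)
  = widen_ord (le_double le) x by exact: val_inj.
apply/permP=> x; have [[y ->]|hx] := wideP leM x.
  rewrite iota_wide; have [[z ->]|hy] := wideP leN y.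
    by rewrite iota_wide !ww iota_wide.
  have hy' : n.*2 <= widen_ord (le_double leM) y by [].
  have [-> _] := iota_high leN p hy; have [-> _] := iota_high le p hy'.
  exact: val_inj.
have hx' : n.*2 <= x by have := le_double leN; lia.
have [-> _] := iota_high leM (iota_fpf leN p) hx.
by have [-> _] := iota_high le p hx'; apply: val_inj.
Qed.

Lemma widen_trans n N M (leN : n <= N) (leM : N <= M) (le : n <= M) f :
  widen_vars leM (widen_vars leN f) = widen_vars le f.
Proof.
apply: (mpoly_int_rmorph_eq (f := comp_mpoly _ \o comp_mpoly _)
  (g := comp_mpoly _)) => x /=.
rewrite -[comp_mpoly _ 'X_x]/(widen_vars leN 'X_x) widen_varE.
rewrite -[LHS]/(widen_vars leM _) -[RHS]/(widen_vars le _) !widen_varE.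
by congr (mpolyX _ U_(_)); apply: val_inj.
Qed.

(** * From the longest element on 2N + 2 points to the one on 2N points *)

Section Sweep.
Variable N : nat.
Local Notation M := (N.+1.*2).
Implicit Types (x y : 'I_M) (k : nat) (p : 'S_M).

(** This is the original label, counted from 1, of position [x] after the first
    [k] conjugations, for all [x <> k]: these cyclically move the first position
    to position [k].  Position [k] itself keeps the weight [k + 1] that it has
    before its own operator is applied. *)
Definition sweep_weight k x : nat := x.+1 + (x < k).

(** The involution obtained from [w0] after [k] conjugations: original labels of
    partners still add up to [2N + 3], and the first position, now at [k],
    stays matched with the last one. *)
Definition swept k p :=
  [/\ p \in fpf_involutions M, forall x, x = k :> nat -> p x = M.-1 :> nat
    & forall x, x != k :> nat -> x != M.-1 :> nat ->
        sweep_weight k x + sweep_weight k (p x) = M.+1].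

Lemma weighted_product_ext t (e e' : 'I_M -> nat) :
  e =1 e' -> weighted_product t e = weighted_product t e'.
Proof. by move=> ee; apply: eq_bigr => x _; apply: eq_bigl => y; rewrite !ee. Qed.

Lemma swept0 : swept 0 (w0 M).
Proof.
have w0E x : w0 M x = M - x.+1 :> nat by rewrite permE.
split=> [|x|x _ _]; last 2 first.
- by rewrite w0E => ->; rewrite subn1.
- by rewrite /sweep_weight w0E; have := ltn_ord x; lia.
apply: fpfP => x; first by rewrite /w0 !permE rev_ordK.
by rewrite -val_eqE /= w0E; have := ltn_ord x; lia.
Qed.

Lemma sweptS k p (i : 'I_M.-1) : i = k :> nat -> k < N.*2 -> swept k p ->
  swept k.+1 (conj_simple i p) /\ ascent i (conj_simple i p).
Proof.
move=> ik kN [fp top spec]; have pK := fpf_invol fp.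
have pk : p (lo i) = M.-1 :> nat by apply: top.
have pi x : x != k :> nat -> p x != M.-1 :> nat.
  apply: contraNneq => e.
  have /perm_inj -> : p x = p (lo i) by apply: val_inj; rewrite [val _]e.
  exact/eqP.
have fix_max x : x = M.-1 :> nat -> simple i x = M.-1 :> nat.
  by move=> xM; rewrite val_simple; do 2?case: ifP; lia.
have nfix x : x != M.-1 :> nat -> simple i x != M.-1 :> nat.
  by move=> xM; rewrite val_simple; do 2?case: ifP; lia.
have nlo x : x != k.+1 :> nat -> simple i x != k :> nat.
  by rewrite val_simple; do 2?case: ifP; lia.
have hik : hi i = k.+1 :> nat by rewrite -ik.
split; last first.
  rewrite /ascent !conj_simpleE simple_lo simple_hi (fix_max _ pk).
  have : simple i (p (hi i)) != M.-1 :> nat by apply/nfix/pi; lia.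
  by have := ltn_ord (simple i (p (hi i))); lia.
split=> [|x xk|x xk xM]; first exact: fpf_conj.
  have -> : x = hi i by apply: val_inj; rewrite [val x]xk.
  by rewrite conj_simpleE simple_hi fix_max.
have weightS y : y != k :> nat -> sweep_weight k.+1 (simple i y) = sweep_weight k y.
  by rewrite /sweep_weight val_simple; do 2?case: ifP; lia.
have sxk := nlo _ xk; have sxM := nfix _ xM.
have psx : p (simple i x) != k :> nat.
  by apply: contraNneq sxM => /top; rewrite pK => ->.
rewrite conj_simpleE (weightS _ psx) -{1}[x](simple_inv i) (weightS _ sxk).
exact: spec.
Qed.

(** The deleted factor pairs position [k] with the position whose weight is
    [2N + 1 - k]; that position has index [2N - k] or [2N - k - 1] according to
    whether it lies after or before [k]. *)
Lemma demazure_sweep k (i : 'I_M.-1) : i = k :> nat -> k < N.*2 ->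
  demazure i (weighted_product M (sweep_weight k)) =
  weighted_product M (sweep_weight k.+1).
Proof.
move=> ik kN.
have cM : (if k + k < N.*2 then N.*2 - k else (N.*2 - k).-1) < M.
  by case: ifP; lia.
rewrite (@demazure_weighted_product _ _ _ _ (Ordinal cM)).
- apply: weighted_product_ext => x.
  by rewrite /raise /sweep_weight -val_eqE /= ik; case: eqP; lia.
- by rewrite /sweep_weight /= ik; lia.
- by rewrite -val_eqE /= ik; case: ifP; lia.
- by rewrite -val_eqE /= ik; case: ifP; lia.
move=> x; rewrite /sweep_weight -!val_eqE /= ik.
by case: ifP; lia.
Qed.

Lemma sweep k : k <= N.*2 ->
  exists2 p, swept k p & path_value p (weighted_product M (sweep_weight k)).
Proof.
elim: k => [_|k IH kN].
  exists (w0 M); first exact: swept0.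
  rewrite (_ : weighted_product _ _ = UpsilonK_w0 M); first exact: TopValue.
  by rewrite UpsilonK_w0E; apply: weighted_product_ext => x; rewrite /sweep_weight addn0.
have [p sp vp] := IH (ltnW kN).
have kM : k < M.-1 by lia.
have ik : Ordinal kM = k :> nat by [].
have [sp' ap'] := sweptS ik kN sp.
exists (conj_simple (Ordinal kM) p) => //.
rewrite -(demazure_sweep ik kN); apply: StepValue => //; first by case: sp'.
by rewrite conj_simpleK.
Qed.

Lemma swept_iota p : swept N.*2 p -> p = iota_fpf (leqnSn N) (w0 N.*2).
Proof.
move=> [fp top spec]; have pK := fpf_invol fp.
apply/permP=> x; apply: val_inj => /=; have xM := ltn_ord x.
have [[y ey]|hx] := wideP (leqnSn N) x.
  rewrite {2}ey iota_wide /= permE /=.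
  have yN := ltn_ord y; have xy : x = y :> nat by rewrite ey.
  have pxN : p x != N.*2 :> nat.
    by apply/eqP=> /top; rewrite pK; lia.
  have := spec x; rewrite /sweep_weight; lia.
have [-> _] := iota_high (leqnSn N) (w0 N.*2) hx; rewrite /=.
have [xN|xN] := eqVneq (x : nat) N.*2; first by rewrite top // xN odd_double; lia.
have oN : N.*2 < M by lia.
have po : p (Ordinal oN) = x by apply: val_inj; rewrite [LHS]top //=; lia.
rewrite -{1}po pK /= ifT; last by lia.
by lia.
Qed.

Lemma weighted_product_sweep :
  weighted_product M (sweep_weight N.*2) =
  widen_vars (leqnSn N) (UpsilonK_w0 N.*2).
Proof.
rewrite widen_UpsilonK_w0; apply: eq_bigr => x _; apply: eq_bigl => y.
by rewrite /sweep_weight; lia.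
Qed.

Lemma path_value_iota_w0 :
  path_value (iota_fpf (leqnSn N) (w0 N.*2))
    (widen_vars (leqnSn N) (UpsilonK_w0 N.*2)).
Proof.
have [p /swept_iota -> vp] := sweep (leqnn N.*2).
by rewrite -weighted_product_sweep.
Qed.

End Sweep.

(** * Independence and stability *)

Lemma path_value_stable n N (leN : n <= N) p f :
  path_value p f -> path_value (iota_fpf leN p) (widen_vars leN f).
Proof.
move=> vp; elim: N leN => [|N IH] leN.
  have n0 : n = 0 by lia.
  by subst n; rewrite iota_refl widen_refl.
have [nN|leN'] : n = N.+1 \/ n <= N by lia.
  by subst n; rewrite iota_refl widen_refl.
rewrite -(iota_trans leN' (leqnSn N)) -(widen_trans leN' (leqnSn N)).
apply: path_value_widen; first exact: path_value_iota_w0.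
exact: IH.
Qed.

Theorem theorem2p2 :
  (forall n : nat, 1 <= n ->
   forall p : 'S_n.*2, p \in fpf_involutions n.*2 ->
   forall w w' : seq 'I_n.*2.-1, labelled_path w p -> labelled_path w' p ->
     demazure_word w (UpsilonK_w0 n.*2) = demazure_word w' (UpsilonK_w0 n.*2))
  /\
  (forall (n N : nat) (leN : n <= N), 1 <= n ->
   forall (p : 'S_n.*2) (fp : p \in fpf_involutions n.*2),
     UpsilonK (iota_fpf_in leN fp) = widen_vars leN (UpsilonK fp)).
Proof.
split=> [n _ p fp w w' pw pw'|n N leN _ p fp].
  by apply: (proj1 (path_value_coherent fp)); apply: labelled_path_value.
have value k (q : 'S_k.*2) (fq : q \in fpf_involutions k.*2) :
    path_value q (UpsilonK fq).
  exact: labelled_path_value (xchooseP (labelled_path_exists fq)).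
apply: (proj1 (path_value_coherent (iota_fpf_in leN fp))); first exact: value.
exact/path_value_stable/value.
Qed.
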